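(* Let $n\ge2$, let $G=SL_n$ or $G=GL_n$, let $w\in W$, let $U'=w^{-1}U(L)w$, and let $M\in G(L)$. Consider the following procedure, performed successively for $i=n,n-1,\dots,1$ on the current matrix (initially $M$): (a) let $r_i\in\{1,\dots,n\}$ be the image of $i$ under the permutation $w^{-1}$; (b) in row $r_i$ of the current matrix, find the entry of minimal valuation, taking the leftmost one among those with this minimal valuation, and let $c_i$ be its column; (c) use column operations by elements of $I$ (right multiplication) to eliminate all other entries of row $r_i$; (d) use row operations by elements of $U'$ (left multiplication) to eliminate all entries of column $c_i$ not in row $r_i$. Then all these steps can be carried out, the resulting matrix is monomial, and after right multiplication by an element of $I$ making its nonzero entries powers of $\epsilon$ it represents the unique element $x\in\widetilde W$ such that $M\in U'xI$.
   Context: Let $\bar k$ be an algebraic closure of a finite field, $L=\bar k((\epsilon))$ with its valuation, and $\mathfrak{o}_L=\bar k[[\epsilon]]$. $A\subset G$ is the diagonal torus, $W$ its Weyl group, identified with the group of permutation matrices ($w e_j=e_{w(j)}$ on standard basis vectors), and $U\subset G$ is the group of upper triangular unipotent matrices. $\widetilde W=W\ltimes X_*(A)$ is the extended affine Weyl group, whose elements are identified with monomial matrices whose nonzero entries are powers of $\epsilon$ (for $SL_n$, with exponents summing to $0$, and up to changing signs of entries to have determinant $1$, which does not affect the cosets considered). $I\subset G(L)$ is the Iwahori subgroup of matrices in $G(L)$ with entries in $\mathfrak{o}_L$, diagonal entries in $\mathfrak{o}_L^\times$, and entries below the diagonal in $\epsilon\mathfrak{o}_L$. $G(L)$ is the disjoint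 union of the sets $U'xI$, $x\in\widetilde W$. *)

(* Defs.v *)
From HB Require Import structures.
From mathcomp Require Import all_boot all_order all_algebra all_fingroup.
From mathcomp Require Import boolp classical_sets fsbigop constructive_ereal.
From mathcomp Require Import zify.

Set Implicit Arguments.
Unset Strict Implicit.
Unset Printing Implicit Defensive.

Import Order.TTheory GRing.Theory Num.Theory.
Local Open Scope ring_scope.

Section LaurentSeries.
Variable K : fieldType.

Definition vanishes_below (f : int -> K) (a : int) := forall i, i < a -> f i = 0.

(* f = \sum_i (lcoef f i) eps^i, with only finitely many negative exponents. *)
Record laurent := Laurent {
  lcoef : int -> K;
  lcoefP : exists a, vanishes_below lcoef a }.

HB.instance Definition _ := gen_eqMixin laurent.
HB.instance Definition _ := gen_choiceMixin laurent.

Lemma laurentP (f g : laurent) : (forall m, lcoef f m = lcoef g m) -> f = g.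
Proof.
case: f g => [f Pf] [g Pg] /= /funext fg.
by case: _ / fg Pg => Pg; congr Laurent; exact: Prop_irrelevance.
Qed.

Lemma vanishesW f a b : b <= a -> vanishes_below f a -> vanishes_below f b.
Proof. by move=> ba fa i ib; apply: fa; apply: lt_le_trans ba. Qed.

Fact const_bounded (c : K) :
  exists a, vanishes_below (fun m => if m == 0 then c else 0) a.
Proof. by exists 0 => i; case: eqVneq => // ->; rewrite ltxx. Qed.
Definition lconst c := Laurent (const_bounded c).

Fact mono_bounded (d : int) :
  exists a, vanishes_below (fun m => (m == d)%:R) a.
Proof. by exists d => i; case: eqVneq => // ->; rewrite ltxx. Qed.
Definition lmono d := Laurent (mono_bounded d).

Fact opp_bounded (f : laurent) : exists a, vanishes_below (fun m => - lcoef f m) a.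
Proof. by have [a fa] := lcoefP f; exists a => i /fa ->; rewrite oppr0. Qed.
Definition lopp f := Laurent (opp_bounded f).

Fact add_bounded (f g : laurent) :
  exists a, vanishes_below (fun m => lcoef f m + lcoef g m) a.
Proof.
have [[a fa] [b gb]] := (lcoefP f, lcoefP g).
exists (Num.min a b) => i; rewrite lt_min => /andP[/fa -> /gb ->].
by rewrite addr0.
Qed.
Definition ladd f g := Laurent (add_bounded f g).

(* All but finitely many terms of this sum over int are zero. *)
Definition cauchy_coef (f g : int -> K) (m : int) : K :=
  \sum_(i \in [set: int]) f i * g (m - i).

Lemma cauchy_coefE f g a b m (N : nat) :
  vanishes_below f a -> vanishes_below g b -> m < a + b + N%:Z ->
  cauchy_coef f g m = \sum_(i < N) f (a + i%:Z) * g (m - (a + i%:Z)).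
Proof.
move=> fa gb mN; rewrite /cauchy_coef.
pose r := [seq a + i%:Z | i <- iota 0 N].
rewrite (fsbigE r) //=.
- rewrite (eq_bigl xpredT); last by move=> i; rewrite in_setT.
  by rewrite big_map -{1}(subn0 N) big_mkord.
- rewrite map_inj_uniq ?iota_uniq // => i j /addrI.
  by case.
- move=> i _ ir; have [ia|ai] := ltrP i a; first by rewrite fa // mul0r.
  rewrite gb ?mulr0 //.
  have [iN|] := ltrP i (a + N%:Z); last by lia.
  case/negP: ir; apply/mapP; exists `|i - a|%N; last by lia.
  by rewrite mem_iota; lia.
Qed.

Lemma cauchy_vanishes f g a b : vanishes_below f a -> vanishes_below g b ->
  vanishes_below (cauchy_coef f g) (a + b).
Proof.
move=> fa gb i iab.
by rewrite (@cauchy_coefE _ _ a b i 0%N) ?big_ord0 // addr0.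
Qed.

Fact mul_bounded (f g : laurent) :
  exists a, vanishes_below (cauchy_coef (lcoef f) (lcoef g)) a.
Proof.
have [[a fa] [b gb]] := (lcoefP f, lcoefP g).
by exists (a + b); apply: cauchy_vanishes.
Qed.
Definition lmul f g := Laurent (mul_bounded f g).

(* p agrees with eps^(-a) * f up to (excluding) degree N. *)
Let approx (a : int) (N : nat) (f : laurent) (p : {poly K}) :=
  vanishes_below (lcoef f) a /\
  forall k, (k < N)%N -> p`_k = lcoef f (a + k%:Z).

Let approx_exists f :
  exists a, forall N, exists p, approx a N f p.
Proof.
have [a fa] := lcoefP f; exists a => N.
exists (\poly_(i < N) lcoef f (a + i%:Z)); split=> // k kN.
by rewrite coef_poly kN.
Qed.

Let approx_eq f g a b : a = b ->
  (forall N, exists2 p, approx a N f p & approx b N g p) -> f = g.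
Proof.
move=> <- H; apply: laurentP => m.
have [p [fa fp] [ga gp]] := H `|m - a|.+1.
have [ma|am] := ltrP m a; first by rewrite fa // ga.
have -> : m = a + `|m - a|%N by lia.
by rewrite -fp // -gp.
Qed.

Let approx_mul a b N f g p q : approx a N f p -> approx b N g q ->
  approx (a + b) N (lmul f g) (p * q).
Proof.
move=> [fa fp] [gb gq]; split; first exact: cauchy_vanishes.
move=> k kN; rewrite coefM /= (@cauchy_coefE _ _ a b _ k.+1) //; last by lia.
apply: eq_bigr => i _; have := ltn_ord i; rewrite ltnS => ik.
rewrite fp ?gq; try lia.
by congr (_ * lcoef g _); lia.
Qed.

Let approx_add a N f g p q : approx a N f p -> approx a N g q ->
  approx a N (ladd f g) (p + q).
Proof.
move=> [fa fp] [ga gq]; split.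
  by move=> i ia /=; rewrite fa // ga // addr0.
by move=> k kN; rewrite coefD fp // gq.
Qed.

Let approx_const N c : approx 0 N (lconst c) c%:P.
Proof.
split; first by move=> i /=; case: eqVneq => // ->; rewrite ltxx.
by move=> k _ /=; rewrite coefC add0r.
Qed.

Fact laddA : associative ladd.
Proof. by move=> f g h; apply: laurentP => m /=; rewrite addrA. Qed.
Fact laddC : commutative ladd.
Proof. by move=> f g; apply: laurentP => m /=; rewrite addrC. Qed.
Fact ladd0 : left_id (lconst 0) ladd.
Proof. by move=> f; apply: laurentP => m /=; rewrite if_same add0r. Qed.
Fact laddN : left_inverse (lconst 0) lopp ladd.
Proof. by move=> f; apply: laurentP => m /=; rewrite if_same addNr. Qed.

HB.instance Definition _ :=
  GRing.isZmodule.Build laurent laddA laddC ladd0 laddN.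

Fact lmulA : associative lmul.
Proof.
move=> f g h.
have [a Hf] := approx_exists f; have [b Hg] := approx_exists g.
have [c Hh] := approx_exists h.
apply: (approx_eq (addrA a b c)) => N.
have [[p fp] [q gq] [r hr]] := And3 (Hf N) (Hg N) (Hh N).
exists (p * (q * r)); last rewrite mulrA; by do 2?[apply: approx_mul => //].
Qed.

Fact lmulC : commutative lmul.
Proof.
move=> f g; have [a Hf] := approx_exists f; have [b Hg] := approx_exists g.
apply: (approx_eq (addrC a b)) => N.
have [[p fp] [q gq]] := (Hf N, Hg N).
by exists (p * q); last rewrite mulrC; apply: approx_mul.
Qed.

Fact lmul1 : left_id (lconst 1) lmul.
Proof.
move=> f; have [a Hf] := approx_exists f; apply: (approx_eq (add0r a)) => N.
have [p fp] := Hf N; exists (1%:P * p); first exact: approx_mul.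
by rewrite mul1r.
Qed.

Fact lmulDl : left_distributive lmul ladd.
Proof.
move=> f g h; have [a fa] := lcoefP f; have [b gb] := lcoefP g.
have [c Hh] := approx_exists h.
pose d := Num.min a b.
have fd : vanishes_below (lcoef f) d by apply: vanishesW fa; rewrite ge_min lexx.
have gd : vanishes_below (lcoef g) d.
  by apply: vanishesW gb; rewrite ge_min lexx orbT.
apply: (approx_eq (erefl (d + c))) => N; have [r hr] := Hh N.
pose P (u : laurent) := \poly_(i < N) lcoef u (d + i%:Z).
have PP u : vanishes_below (lcoef u) d -> approx d N u (P u).
  by move=> ud; split=> // k kN; rewrite coef_poly kN.
exists ((P f + P g) * r); first by apply: approx_mul => //; apply: approx_add; apply: PP.
by rewrite mulrDl; apply: approx_add; apply: approx_mul => //; apply: PP.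
Qed.

Fact lone_neq0 : lconst 1 != 0.
Proof. by apply/eqP => /(congr1 (lcoef^~ 0))/eqP /=; rewrite oner_eq0. Qed.

HB.instance Definition _ :=
  GRing.Zmodule_isComNzRing.Build laurent lmulA lmulC lmul1 lmulDl lone_neq0.

Lemma lcoef_ex_min (f : laurent) : f != 0 ->
  exists a, lcoef f a != 0 /\ vanishes_below (lcoef f) a.
Proof.
move=> f0; have [b fb] := lcoefP f.
have ex : exists k : nat, lcoef f (b + k%:Z) != 0.
  apply: contra_neqP f0 => nex; apply: laurentP => m /=; rewrite if_same.
  have [mb|bm] := ltrP m b; first exact: fb.
  have -> : m = b + `|m - b|%N by lia.
  by apply/eqP; apply: contra_notT nex => ?; exists `|m - b|%N.
exists (b + (ex_minn ex)%:Z); case: ex_minnP => k fk kmin; split=> // i ik.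
have [ib|bi] := ltrP i b; first exact: fb.
apply/eqP; apply: contraTT ik => fi; rewrite -leNgt.
suff : (k <= `|i - b|)%N by lia.
by apply: kmin; have <- : i = b + `|i - b|%N by lia.
Qed.

Let linv_coef (f : laurent) (a : int) : nat -> K :=
  fun n => nth 0 (iter n.+1 (fun s => rcons s
    ((lcoef f a)^-1 * ((size s == 0%N)%:R -
      \sum_(i < size s) lcoef f (a + (size s - i)%N%:Z) * s`_i))) [::]) n.

Let linv_coefE f a n : linv_coef f a n = (lcoef f a)^-1 * ((n == 0%N)%:R -
  \sum_(i < n) lcoef f (a + (n - i)%N%:Z) * linv_coef f a i).
Proof.
rewrite /linv_coef; set step := fun s => rcons s _.
have sz k : size (iter k step [::]) = k by elim: k => //= k IH; rewrite size_rcons IH.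
have stab k j : (j < k)%N ->
    nth 0 (iter k step [::]) j = nth 0 (iter j.+1 step [::]) j.
  elim: k => // k IH; rewrite ltnS leq_eqVlt => /predU1P[->//|jk].
  by rewrite iterS {1}/step nth_rcons sz jk IH.
rewrite iterS {1}/step nth_rcons !sz ltnn eqxx.
congr (_ * (_ - _)); apply: eq_bigr => i _.
by rewrite (stab n i).
Qed.

Fact lmulV_ex (f : laurent) : f != 0 -> exists g : laurent, g * f = 1.
Proof.
move=> /lcoef_ex_min[a [fa0 fa]].
pose gc (m : int) : K := if m < - a then 0 else linv_coef f a (absz (m + a)).
have gb : vanishes_below gc (- a) by move=> i ia; rewrite /gc ia.
have gex : exists b, vanishes_below gc b by exists (- a).
exists (Laurent gex); apply: laurentP => m /=.
have [m0|m0] := ltrP m 0.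
  rewrite (cauchy_vanishes gb fa) ?addNr //.
  by rewrite ifN //; lia.
have [n ->] : exists n : nat, m = n%:Z by exists `|m|%N; lia.
rewrite (@cauchy_coefE _ _ (- a) a _ n.+1) //; last by lia.
rewrite big_ord_recr /=.
have gE (i : nat) : gc (- a + i%:Z) = linv_coef f a i.
  by rewrite /gc ifN; [congr linv_coef; lia | lia].
rewrite gE linv_coefE.
have -> : n%:Z - (- a + n%:Z) = a by lia.
rewrite mulrAC mulVf // mul1r addrC -addrA.
rewrite [X in _ + X](_ : _ = 0) ?addr0; first by case: n.
apply/eqP; rewrite addrC subr_eq0; apply/eqP/eq_bigr => i _.
by rewrite gE mulrC; congr (lcoef f _ * _); have := ltn_ord i; lia.
Qed.

Definition linv (f : laurent) : laurent :=
  if pselect (f != 0) is left f0 then sval (cid (lmulV_ex f0)) else 0.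

Fact lmulVf (f : laurent) : f != 0 -> linv f * f = 1.
Proof. by rewrite /linv; case: pselect => // f0 _; case: cid. Qed.

Fact linv0 : linv 0 = 0.
Proof. by rewrite /linv; case: pselect => // z; case: (negP z). Qed.

HB.instance Definition _ := GRing.ComNzRing_isField.Build laurent lmulVf linv0.

Definition eps : laurent := lmono 1.

Definition valuation (f : laurent) : \bar int :=
  if pselect (f != 0) is left f0 then (sval (cid (lcoef_ex_min f0)))%:E
  else +oo%E.

Lemma valuation0 : valuation 0 = +oo%E.
Proof. by rewrite /valuation; case: pselect => // z; case: (negP z). Qed.

Lemma valuationE (f : laurent) (a : int) :
  lcoef f a != 0 -> vanishes_below (lcoef f) a -> valuation f = a%:E.
Proof.
move=> fa0 fa; rewrite /valuation; case: pselect => [f0|nf0].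
  case: cid => b /= [fb0 fb]; congr (_%:E).
  by apply: le_anti; rewrite !leNgt; apply/andP; split;
    [move: fa0|move: fb0]; apply: contra; [move=> /fb|move=> /fa] => ->.
by case: nf0; apply: contraNneq fa0 => ->; rewrite /= if_same.
Qed.

Definition is_integral (f : laurent) := vanishes_below (lcoef f) 0.

Definition is_integral_unit (f : laurent) :=
  is_integral f /\ exists2 g, is_integral g & f * g = 1.

Definition is_eps_integral (f : laurent) :=
  exists2 g, is_integral g & f = eps * g.

End LaurentSeries.

Arguments eps {K}.

Variant group_kind := SL | GL.

Section IwahoriDecomposition.
Variables (k : fieldType) (n : nat) (G : group_kind).
Local Notation L := (laurent k).
Implicit Types (w s : 'S_n) (lam : 'I_n -> int) (r c : 'I_n).
Implicit Types M N g u x : 'M[L]_n.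

Definition group_points M : Prop :=
  match G with SL => \det M = 1 | GL => M \in unitmx end.

Definition iwahori g :=
  [/\ group_points g,
      forall i j, is_integral (g i j),
      forall i, is_integral_unit (g i i) &
      forall i j : 'I_n, (j < i)%N -> is_eps_integral (g i j)].

Definition unipotent_upper u :=
  (forall i, u i i = 1) /\ (forall i j : 'I_n, (j < i)%N -> u i j = 0).

(* The matrix with e_j |-> e_(w j); perm_mx w has its j-th row, not column,
   at w j. *)
Definition weyl_mx w : 'M[L]_n := perm_mx (w^-1)%g.

Definition conj_unipotent w u' :=
  exists2 u, unipotent_upper u & u' = invmx (weyl_mx w) *m u *m weyl_mx w.

(* The element eps^lam . s of W |x X_*(A) is encoded by the pair (s, lam). *)
Definition ext_weyl : Type := ('S_n * {ffun 'I_n -> int})%type.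

Definition in_ext_weyl (x : ext_weyl) : Prop :=
  match G with SL => \sum_i x.2 i = 0 | GL => True end.

Definition ext_weyl_mx (x : ext_weyl) : 'M[L]_n :=
  diag_mx (\row_i eps ^ x.2 i) *m weyl_mx x.1.

(* For SL the monomial matrix of x may have determinant -1, and is then only
   defined in G(L) up to signs of its entries. *)
Definition represents M (x : ext_weyl) : Prop :=
  match G with
  | SL => \det M = 1 /\ exists b : 'I_n -> bool,
            M = diag_mx (\row_i (-1) ^+ b i) *m ext_weyl_mx x
  | GL => M = ext_weyl_mx x
  end.

Definition in_double_coset w (x : ext_weyl) M :=
  exists u xm g, [/\ conj_unipotent w u, represents xm x, iwahori g &
                     M = u *m xm *m g].

Definition is_monomial M :=
  exists s : 'S_n, forall i j, (M i j != 0) = (i == s j).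

Definition pivot M r c :=
  (forall j, (valuation (M r c) <= valuation (M r j))%E) /\
  (forall j : 'I_n, (j < c)%N -> (valuation (M r c) < valuation (M r j))%E).

(* Right multiplication by g below adds multiples of column c to the other
   columns. *)
Definition clear_row r c M M' :=
  exists g, [/\ iwahori g,
                forall i j, i != c \/ j = c -> g i j = (i == j)%:R,
                M' = M *m g &
                forall j, j != c -> M' r j = 0].

(* Left multiplication by u below adds multiples of row r to the other rows. *)
Definition clear_column w r c M M' :=
  exists u, [/\ conj_unipotent w u,
                forall i j, j != r \/ i = r -> u i j = (i == j)%:R,
                M' = u *m M &
                forall i, i != r -> M' i c = 0].

(* reached w M m N: N is a current matrix after m rounds starting from M. As
   'I_n is {0, ..., n-1}, the round following m completed ones uses the index
   i with i + m + 1 = n, and the row w^-1 i. *)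
Inductive reached w M : nat -> 'M[L]_n -> Prop :=
| Start : reached w M 0 M
| Round m N (i c : 'I_n) N1 N2 of
    reached w M m N & (i + m.+1)%N = n &
    pivot N ((w^-1)%g i) c &
    clear_row ((w^-1)%g i) c N N1 &
    clear_column w ((w^-1)%g i) c N1 N2 :
    reached w M m.+1 N2.

(* Whatever was done so far, each part of each round can be performed. *)
Definition always_feasible w M :=
  forall m N (i : 'I_n), reached w M m N -> (i + m.+1)%N = n ->
  let r := (w^-1)%g i in
  (exists c, pivot N r c) /\
  (forall c, pivot N r c -> exists N1, clear_row r c N N1) /\
  (forall c N1, pivot N r c -> clear_row r c N N1 ->
     exists N2, clear_column w r c N1 N2).

End IwahoriDecomposition.

(* Main.v *)
(* Feasibility and correctness rest on one invariant: after m rounds the current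
   matrix N satisfies M = u N g with u in U' and g in I, and each processed row
   is isolated, i.e. it has a single nonzero entry, which is also the only one
   in its column.  The pivot of the next row therefore avoids the columns already
   used, so column operations leave the processed rows alone, and the entries
   to clear in the pivot column lie in unprocessed rows, which is exactly
   what U' allows.
   Uniqueness of x: if u x = y g with u in U' and g in I, the diagonal of g
   consists of units, so u has nonzero entries at (t j, s j), where s, t are the
   permutations of x, y.  Hence w (t j) <= w (s j) for all j, so s = t, and then
   the exponents agree. *)
Require Import Defs.
From mathcomp Require Import all_boot all_order all_algebra all_fingroup.
From mathcomp Require Import constructive_ereal.
From mathcomp Require Import zify.

Set Implicit Arguments.
Unset Strict Implicit.
Unset Printing Implicit Defensive.

Import Order.TTheory GRing.Theory Num.Theory.
Local Open Scope ring_scope.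

(** * Upper triangular matrices over a field *)

Section UpperTriangular.
Variables (F : fieldType) (n : nat).
Implicit Types A B : 'M[F]_n.

Definition upper_trig A := forall i j : 'I_n, (j < i)%N -> A i j = 0.

Lemma upper_trig_mul A B : upper_trig A -> upper_trig B -> upper_trig (A *m B).
Proof.
move=> uA uB i j ji; rewrite mxE big1 // => l _.
have [/uA->|il] := ltnP l i; first by rewrite mul0r.
by rewrite uB ?mulr0 //; apply: leq_trans il.
Qed.

Lemma upper_trig_mul_diag A B i :
  upper_trig A -> upper_trig B -> (A *m B) i i = A i i * B i i.
Proof.
move=> uA uB; rewrite mxE (bigD1 i) //= big1 ?addr0 // => l li.
have [/uA->|/uB->|/val_inj il] := ltngtP l i; rewrite ?mul0r ?mulr0 //.
by rewrite il eqxx in li.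
Qed.

Lemma upper_trig_det A : upper_trig A -> \det A = \prod_i A i i.
Proof.
move=> uA; rewrite -det_tr det_trig; first by apply: eq_bigr => i _; rewrite mxE.
by apply/is_trig_mxP => i j ij; rewrite mxE uA.
Qed.

Lemma upper_trig_unitmx A :
  upper_trig A -> (forall i, A i i != 0) -> A \in unitmx.
Proof.
move=> uA A0; rewrite unitmxE upper_trig_det // unitfE.
by apply/prodf_neq0 => i _; apply: A0.
Qed.

(** Induction from the last row upwards: for [j < i] the entry [(i, j)] of [A *m B] reduces to
    [A i i * B i j]. *)
Lemma upper_trig_inv A B :
  upper_trig A -> (forall i, A i i != 0) -> A *m B = 1%:M -> upper_trig B.
Proof.
move=> uA A0 AB i j; have [m] := ubnP (n - i); elim: m i => // m IH i im ji.
have /matrixP/(_ i j) := AB; rewrite !mxE (bigD1 i) //= big1 => [|l li].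
  rewrite addr0 -val_eqE gtn_eqF //= => /eqP.
  by rewrite mulf_eq0 (negbTE (A0 i)) => /eqP.
have [/uA->|il|/val_inj il] := ltngtP l i; first by rewrite mul0r.
  by rewrite IH ?mulr0 //; [have := ltn_ord l; lia|apply: ltn_trans il].
by rewrite il eqxx in li.
Qed.

End UpperTriangular.

(** Carries the factorization [M = u N g] across a round, which replaces [N] by [v N h]. *)
Lemma mulmx_insert_inv (F : fieldType) n (u v N h g : 'M[F]_n) :
  v \in unitmx -> h \in unitmx ->
  u *m N *m g = (u *m invmx v) *m (v *m (N *m h)) *m (invmx h *m g).
Proof. by move=> uv uh; rewrite !mulmxA mulmxKV // mulmxK. Qed.

(** * Laurent series: units, valuation and divisibility *)

Section Laurent.
Variable K : fieldType.
Local Notation L := (laurent K).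
Implicit Types f g : L.

Lemma lcoefD f g a : lcoef (f + g) a = lcoef f a + lcoef g a.
Proof. by []. Qed.

Lemma lcoefN f a : lcoef (- f) a = - lcoef f a.
Proof. by []. Qed.

Lemma lcoef0 a : lcoef (0 : L) a = 0.
Proof. exact: if_same. Qed.

Lemma lcoef1 a : lcoef (1 : L) a = (a == 0)%:R.
Proof. by rewrite /=; case: eqP. Qed.

Lemma lcoef_sum (I : finType) (E : I -> L) a :
  lcoef (\sum_i E i) a = \sum_i lcoef (E i) a.
Proof.
by apply: (big_morph (fun f => lcoef f a)) => [f g|]; [exact: lcoefD|exact: lcoef0].
Qed.

Lemma vanishes_belowM f g a b : vanishes_below (lcoef f) a ->
  vanishes_below (lcoef g) b -> vanishes_below (lcoef (f * g)) (a + b).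
Proof. exact: cauchy_vanishes. Qed.

(** Only the product of the two lowest terms reaches the exponent [a + b]. *)
Lemma lcoefM_low f g a b : vanishes_below (lcoef f) a ->
  vanishes_below (lcoef g) b -> lcoef (f * g) (a + b) = lcoef f a * lcoef g b.
Proof.
move=> fa gb; rewrite [LHS](cauchy_coefE (N := 1) fa gb) ?big_ord1; last by lia.
by congr (lcoef f _ * lcoef g _); rewrite /=; lia.
Qed.

Lemma lcoef_lmono_mul d f m : lcoef (lmono K d * f) m = lcoef f (m - d).
Proof.
have [a fa] := lcoefP f.
have dd : vanishes_below (lcoef (lmono K d)) d.
  by move=> i /=; case: eqVneq => // ->; rewrite ltxx.
(* [N] makes the truncated sum reach past [m]; only its first term can be nonzero. *)
have [N mN] : exists N : nat, m < d + a + N.+1%:Z by exists (absz (m - d - a)%R); lia.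
rewrite [LHS](cauchy_coefE dd fa mN) big_ord_recl /= big1 => [|i _].
  by rewrite !addr0 eqxx mul1r.
by rewrite (_ : _ == d = false) ?mul0r // /bump /=; lia.
Qed.

Lemma lmonoD c d : lmono K (c + d) = lmono K c * lmono K d.
Proof.
apply: laurentP => m; rewrite lcoef_lmono_mul /=; congr (_%:R).
by congr nat_of_bool; lia.
Qed.

Lemma lmono0 : lmono K 0 = 1.
Proof. by apply: laurentP => m; rewrite lcoef1. Qed.

Lemma eps_neq0 : (eps : L) != 0.
Proof.
apply/eqP => /(congr1 (fun f : L => lcoef f 1)); rewrite lcoef0 /= => /eqP.
by rewrite oner_eq0.
Qed.

Lemma expz_eps d : (eps : L) ^ d = lmono K d.
Proof.
have epsn (m : nat) : (eps : L) ^+ m = lmono K m%:Z.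
  elim: m => [|m IH]; first by rewrite expr0 lmono0.
  by rewrite exprS IH -lmonoD intS.
case: d => m; first by rewrite -exprnP epsn.
apply: (mulIf (expf_neq0 m.+1 eps_neq0)); rewrite NegzE -exprnN.
rewrite mulVf ?expf_neq0 ?eps_neq0 //.
by rewrite epsn -lmonoD addNr lmono0.
Qed.

Lemma lcoef_expz_eps_mul d f m : lcoef (eps ^ d * f) m = lcoef f (m - d).
Proof. by rewrite expz_eps lcoef_lmono_mul. Qed.

Lemma expz_eps_neq0 d : (eps : L) ^ d != 0.
Proof. exact: expfz_neq0 eps_neq0. Qed.

(** The units of [o_L], described by the constant term, as [integral_unitP] confirms. *)
Definition val0 f := is_integral f /\ lcoef f 0 != 0.

Lemma val0_neq0 f : val0 f -> f != 0.
Proof. by move=> [_]; apply: contraNneq => ->; rewrite lcoef0. Qed.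

Lemma integralM f g : is_integral f -> is_integral g -> is_integral (f * g).
Proof. by move=> fi gi; have := vanishes_belowM fi gi; rewrite addr0. Qed.

Lemma val0M f g : val0 f -> val0 g -> val0 (f * g).
Proof.
move=> [fi f0] [gi g0]; split; first exact: integralM.
by have := lcoefM_low fi gi; rewrite addr0 => ->; rewrite mulf_neq0.
Qed.

Lemma val0N f : val0 f -> val0 (- f).
Proof.
move=> [fi f0]; split=> [i i0|]; first by rewrite lcoefN fi // oppr0.
by rewrite lcoefN oppr_eq0.
Qed.

Lemma val0_1 : val0 1.
Proof.
split=> [i i0|]; last by rewrite lcoef1 eqxx oner_eq0.
by rewrite lcoef1 lt_eqF.
Qed.

Lemma val0_prod (I : finType) (E : I -> L) :
  (forall i, val0 (E i)) -> val0 (\prod_i E i).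
Proof. by move=> E0; apply: big_ind => [|f g|//]; [exact: val0_1|exact: val0M]. Qed.

Lemma val0_sign (b : bool) : val0 ((-1) ^+ b).
Proof. by case: b; [apply: val0N|]; exact: val0_1. Qed.

Lemma neq0_eps_val0 f : f != 0 ->
  exists a u, val0 u /\ f = eps ^ a * u.
Proof.
move=> /lcoef_ex_min[a [fa0 fa]]; exists a, (eps ^ (- a) * f); split.
  split=> [i i0|]; rewrite lcoef_expz_eps_mul; last by rewrite sub0r opprK.
  by apply: fa; lia.
by rewrite mulrA -expfzDr ?eps_neq0 // subrr expr0z mul1r.
Qed.

Lemma eps_val0_valuation a f : val0 f -> valuation (eps ^ a * f) = a%:E.
Proof.
move=> [fi f0]; apply: valuationE => [|i ia]; rewrite lcoef_expz_eps_mul.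
  by rewrite subrr.
by apply: fi; lia.
Qed.

Lemma eps_val0_inj a b f g : val0 f -> val0 g ->
  eps ^ a * f = eps ^ b * g -> a = b.
Proof.
move=> f0 g0 /(congr1 (@valuation K)).
by rewrite !eps_val0_valuation // => -[].
Qed.

(** Writing the inverse as [eps ^ b * v] with [v] a unit and comparing exponents in [f * f^-1 = 1]
    forces [b = 0]. *)
Lemma val0V f : val0 f -> val0 f^-1.
Proof.
move=> f0; have fn0 := val0_neq0 f0.
have [|b [v [v0 fE]]] := @neq0_eps_val0 f^-1; first by rewrite invr_eq0.
suff b0 : b = 0 by rewrite fE b0 expr0z mul1r.
apply: (eps_val0_inj (val0M f0 v0) val0_1).
by rewrite expr0z mul1r mulrCA -fE divff.
Qed.

Lemma integral_unitP f : is_integral_unit f <-> val0 f.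
Proof.
split=> [[fi [g gi fg]]|f0]; last first.
  by split; [case: f0|exists f^-1; [case: (val0V f0)|rewrite divff ?val0_neq0]].
split=> //; have := lcoefM_low fi gi; rewrite fg addr0 lcoef1 eqxx => /eqP.
by apply: contraTneq => ->; rewrite mul0r oner_eq0.
Qed.

Lemma eps_integralP f : is_eps_integral f <-> vanishes_below (lcoef f) 1.
Proof.
split=> [[g gi ->] i i1|f1].
  by rewrite -(expr1z eps) lcoef_expz_eps_mul gi //; lia.
exists (eps ^ (-1) * f) => [i i0|]; last first.
  by rewrite -[X in X * (_ * _)]expr1z mulrA -expfzDr ?eps_neq0 // expr0z mul1r.
by rewrite lcoef_expz_eps_mul f1 //; lia.
Qed.

Lemma valuation_vanishes f a : (a%:E <= valuation f)%E -> vanishes_below (lcoef f) a.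
Proof.
have [->|/neq0_eps_val0[b [u [u0 ->]]]] := eqVneq f 0.
  by move=> _ i _; rewrite lcoef0.
rewrite eps_val0_valuation // lee_fin => ab i ia; rewrite lcoef_expz_eps_mul.
by apply: (proj1 u0); lia.
Qed.

Lemma valuation_ltW f a : (a%:E < valuation f)%E -> ((a + 1)%:E <= valuation f)%E.
Proof.
have [->|/neq0_eps_val0[b [u [u0 ->]]]] := eqVneq f 0.
  by rewrite valuation0 leey.
by rewrite eps_val0_valuation // lte_fin lee_fin; lia.
Qed.

Lemma vanishes_div a b u g : val0 u -> vanishes_below (lcoef g) (a + b) ->
  vanishes_below (lcoef (g / (eps ^ a * u))) b.
Proof.
move=> u0 gb; rewrite invfM invr_expz mulrA -[b]addr0.
apply: vanishes_belowM; last by case: (val0V u0).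
by move=> i ib; rewrite mulrC lcoef_expz_eps_mul gb //; lia.
Qed.

Lemma valuation_le_div f g : f != 0 ->
  (valuation f <= valuation g)%E -> is_integral (g / f).
Proof.
move=> /neq0_eps_val0[a [u [u0 ->]]]; rewrite eps_val0_valuation // => ag.
by apply: vanishes_div; rewrite ?addr0 //; apply: valuation_vanishes.
Qed.

Lemma valuation_lt_div f g : f != 0 ->
  (valuation f < valuation g)%E -> vanishes_below (lcoef (g / f)) 1.
Proof.
move=> /neq0_eps_val0[a [u [u0 ->]]]; rewrite eps_val0_valuation // => ag.
by apply: vanishes_div => //; apply/valuation_vanishes/valuation_ltW.
Qed.

End Laurent.

(** * The groups [G(L)], [I] and [U'] *)

Section Groups.
Variables (K : fieldType) (n : nat) (G : group_kind).
Local Notation L := (laurent K).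
Implicit Types (M N g h u : 'M[L]_n) (w : 'S_n).

Lemma group_points_unitmx M : group_points G M -> M \in unitmx.
Proof. by case: G => //= dM; rewrite unitmxE dM unitr1. Qed.

Lemma group_points_det1 M : \det M = 1 -> group_points G M.
Proof. by case: G => //= dM; rewrite unitmxE dM unitr1. Qed.

Lemma group_points_mul M N :
  group_points G M -> group_points G N -> group_points G (M *m N).
Proof.
case: G => /= [dM dN|uM uN]; first by rewrite det_mulmx dM dN mulr1.
by rewrite unitmx_mul uM.
Qed.

Lemma group_points_inv M : group_points G M -> group_points G (invmx M).
Proof. by case: G => /= [dM|uM]; rewrite ?unitmx_inv // det_inv dM invr1. Qed.

(** Reduction modulo [eps] is the case [a = 0]; negative [a] serve to prove inverses integral in
    [iwahori_inv]. *)
Definition coef_mx (a : int) (g : 'M[L]_n) : 'M[K]_n :=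
  \matrix_(i, j) lcoef (g i j) a.

Definition integral_mx g := forall i j, is_integral (g i j).

Lemma integral_mx_mul g h : integral_mx g -> integral_mx h -> integral_mx (g *m h).
Proof.
move=> gi hi i j a a0; rewrite mxE lcoef_sum big1 // => l _.
exact: (integralM (gi i l) (hi l j)).
Qed.

Lemma coef_mx_mul a g h : integral_mx g ->
  (forall i j, vanishes_below (lcoef (h i j)) a) ->
  coef_mx a (g *m h) = coef_mx 0 g *m coef_mx a h.
Proof.
move=> gi ha; apply/matrixP => i j; rewrite !mxE lcoef_sum.
apply: eq_bigr => l _; rewrite !mxE.
by have := lcoefM_low (gi i l) (ha l j); rewrite add0r.
Qed.

Lemma coef_mx1 a : coef_mx a 1%:M = (a == 0)%:R%:M.
Proof.
apply/matrixP => i j; rewrite !mxE; rewrite -[(i == j)%:R]/((i == j)%:R : L).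
case: (i == j); last by rewrite lcoef0 mulr0n.
by rewrite lcoef1 mulr1n.
Qed.

(* The Iwahori subgroup is the preimage of the Borel subgroup under
   reduction modulo eps. *)
Lemma iwahoriP g : iwahori G g <->
  [/\ group_points G g, integral_mx g, upper_trig (coef_mx 0 g) &
      forall i, coef_mx 0 g i i != 0].
Proof.
split=> [[gG gi gd gl]|[gG gi gl gd]].
  split=> // [i j ji|i]; rewrite mxE.
    by have /eps_integralP -> := gl _ _ ji.
  by have /integral_unitP[] := gd i.
split=> // [i|i j ji].
  by apply/integral_unitP; split=> //; have := gd i; rewrite mxE.
apply/eps_integralP => a a1; have [->|a0] := eqVneq a 0.
  by have := gl i j ji; rewrite mxE.
by apply: gi; lia.
Qed.

Lemma iwahori_mul g h : iwahori G g -> iwahori G h -> iwahori G (g *m h).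
Proof.
move=> /iwahoriP[gG gi gl gd] /iwahoriP[hG hi hl hd]; apply/iwahoriP.
split; [exact: group_points_mul|exact: integral_mx_mul| |].
  by rewrite coef_mx_mul //; apply: upper_trig_mul.
by move=> i; rewrite coef_mx_mul // upper_trig_mul_diag // mulf_neq0.
Qed.

Lemma iwahori1 : iwahori G (1%:M : 'M[L]_n).
Proof.
apply/iwahoriP; split=> [|i j|i j ji|i].
- by apply: group_points_det1; rewrite det1.
- rewrite mxE; case: eqP => _; first exact: (proj1 (val0_1 K)).
  by move=> a _; rewrite lcoef0.
- by rewrite coef_mx1 eqxx mxE -val_eqE gtn_eqF.
- by rewrite coef_mx1 !mxE !eqxx oner_eq0.
Qed.

(** A common lower bound for the exponents in [h] is raised step by step to 0; then [g *m h = 1] is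
    reduced modulo [eps], where it becomes an identity of upper triangular matrices. *)
Lemma iwahori_inv g : iwahori G g -> iwahori G (invmx g).
Proof.
move=> /iwahoriP[gG gi gl gd]; set h := invmx g.
have gh : g *m h = 1%:M by rewrite mulmxV // group_points_unitmx.
have red_unit : coef_mx 0 g \in unitmx by apply: upper_trig_unitmx.
have [a0 ha0] : exists a, forall i j, vanishes_below (lcoef (h i j)) a.
  have [f fP] : exists f : 'I_n * 'I_n -> int,
      forall p, vanishes_below (lcoef (h p.1 p.2)) (f p).
    apply: (fin_all_exists (U := fun=> int)
      (P := fun p a => vanishes_below (lcoef (h p.1 p.2)) a)) => p.
    exact: lcoefP.
  exists (- (\sum_p `|f p|)) => i j a af; apply: (fP (i, j)).
  have : `|f (i, j)| <= \sum_p `|f p|.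
    by rewrite (bigD1 (i, j)) //= lerDl sumr_ge0.
  lia.
have hi : integral_mx h.
  (* The lowest coefficient matrix X of h satisfies coef_mx 0 g *m X = 0 as
     long as its exponent is negative. *)
  suff H (m : nat) i j : vanishes_below (lcoef (h i j)) (Num.min 0 (a0 + m%:Z)).
    move=> i j; apply: vanishesW (H (absz a0) i j).
    by rewrite le_min lexx; lia.
  elim: m i j => [|m IH] i j.
    by rewrite addr0; apply: vanishesW (ha0 i j); rewrite ge_min lexx orbT.
  move=> a; rewrite lt_min => /andP[a_lt0 a_lt].
  have [am|ma] := ltrP a (a0 + m%:Z); first by apply: IH; rewrite lt_min a_lt0.
  (* Here [a0 + m <= a < a0 + m + 1] and [a < 0], so [a] is exactly the current bound. *)
  have ea : a = Num.min 0 (a0 + m%:Z) by rewrite /Num.min; case: ifP; lia.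
  have := coef_mx_mul gi (a := a) (h := h); rewrite {1}ea => /(_ IH).
  rewrite gh coef_mx1 (lt_eqF a_lt0) => /(congr1 (mulmx (invmx (coef_mx 0 g)))).
  by rewrite mulKmx // raddf0 mulmx0 => /matrixP/(_ i j); rewrite !mxE.
have redgh : coef_mx 0 g *m coef_mx 0 h = 1%:M.
  by rewrite -coef_mx_mul // gh coef_mx1.
have hl := upper_trig_inv gl gd redgh.
apply/iwahoriP; split=> // [|i]; first exact: group_points_inv.
have := upper_trig_mul_diag i gl hl; rewrite redgh mxE eqxx => /eqP.
by apply: contraTneq => ->; rewrite mulr0 oner_eq0.
Qed.

Lemma weyl_mxE w i j : weyl_mx K w i j = (i == w j)%:R.
Proof. by rewrite !mxE -(inj_eq (@perm_inj _ w)) permKV. Qed.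

(** Conjugation by [w] relabels rows and columns, so [U'] consists of the unipotent matrices that
    are upper triangular for the order of the values [w i]. *)
Lemma conj_unipotentP w u : conj_unipotent w u <->
  (forall i, u i i = 1) /\ (forall i j : 'I_n, (w j < w i)%N -> u i j = 0).
Proof.
have conjE v i j : (invmx (weyl_mx K w) *m v *m weyl_mx K w) i j = v (w i) (w j).
  have -> : invmx (weyl_mx K w) = perm_mx w.
    by rewrite -[LHS]mul1mx -(perm_mx1 L) -(mulgV w) perm_mxM mulmxK ?unitmx_perm.
  by rewrite -row_permE -col_permE !mxE.
split=> [[v [v1 v0] ->]|[u1 u0]]; first by split=> [i|i j]; rewrite conjE; auto.
exists (\matrix_(i, j) u (w^-1 i)%g (w^-1 j)%g).
  by split=> [i|i j ji]; rewrite mxE ?u1 // u0 // !permKV.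
by apply/matrixP => i j; rewrite conjE mxE !permK.
Qed.


Lemma conj_unipotent_mul w u v :
  conj_unipotent w u -> conj_unipotent w v -> conj_unipotent w (u *m v).
Proof.
move=> [a [a1 al] ->] [b [b1 bl] ->]; exists (a *m b).
  by split=> [i|]; [rewrite upper_trig_mul_diag // a1 b1 mulr1|apply: upper_trig_mul].
by rewrite !mulmxA mulmxK ?unitmx_perm.
Qed.

Lemma conj_unipotent1 w : conj_unipotent w (1%:M : 'M[L]_n).
Proof.
apply/conj_unipotentP; split=> [i|i j ji]; rewrite mxE ?eqxx //.
by case: eqP ji => // ->; rewrite ltnn.
Qed.

Lemma conj_unipotent_det w u : conj_unipotent w u -> \det u = 1.
Proof.
move=> [a [a1 al] ->]; rewrite -mulmxA det_mulmx det_mulmx mulrCA -det_mulmx.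
rewrite mulVmx ?unitmx_perm // det1 mulr1 upper_trig_det // big1 //.
Qed.

Lemma conj_unipotent_inv w u : conj_unipotent w u -> conj_unipotent w (invmx u).
Proof.
move=> [a [a1 al] ->].
have a0 i : a i i != 0 by rewrite a1 oner_eq0.
have ua : a \in unitmx by apply: upper_trig_unitmx.
have aV : upper_trig (invmx a) by apply: (upper_trig_inv al a0); rewrite mulmxV.
have uW : weyl_mx K w \in unitmx by apply: unitmx_perm.
exists (invmx a); first split=> // i.
  have := upper_trig_mul_diag i al aV.
  by rewrite mulmxV // mxE eqxx a1 mul1r.
set W := weyl_mx K w; set x := invmx W *m _ *m W.
have ux : x \in unitmx by rewrite !unitmx_mul unitmx_inv uW ua.
rewrite -[RHS](mulKmx ux) (_ : x *m _ = 1%:M) ?mulmx1 //.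
by rewrite /x !mulmxA mulmxK // mulmxK // mulVmx.
Qed.

(** Expand along column [c], which is that of the identity; deleting row and column [c] leaves an
    identity matrix. *)
Lemma det_row_elementary (c : 'I_n) g :
  (forall i j, i != c \/ j = c -> g i j = (i == j)%:R) -> \det g = 1.
Proof.
move=> gE; rewrite (expand_det_col g c) (bigD1 c) //= big1 => [|i ic]; last first.
  by rewrite gE ?(negbTE ic) ?mul0r //; left.
rewrite gE; last by right.
rewrite eqxx mul1r addr0 /cofactor (_ : row' _ _ = 1%:M) ?det1.
  by rewrite mulr1 -signr_odd oddD addbb.
apply/matrixP => i j; rewrite !mxE gE; last by left; rewrite eq_sym neq_lift.
by rewrite (inj_eq lift_inj).
Qed.

(** Strong induction: if [s i < i], then [s] fixes [s i], and injectivity gives [s i = i]. *)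
Lemma perm_le_id (s : 'S_n) : (forall i : 'I_n, (s i <= i)%N) -> s = 1%g.
Proof.
move=> sle; apply/permP => i; rewrite perm1.
have [m] := ubnP i; elim: m i => // m IH i im.
have := sle i; rewrite leq_eqVlt => /predU1P[/val_inj//|si].
by apply: (@perm_inj _ s); apply: IH; apply: leq_trans si _.
Qed.

Lemma perm_le_eq (s t : 'S_n) : (forall i, (s i <= t i)%N) -> s = t.
Proof.
move=> st; suff : (t^-1 * s = 1)%g by move/(canRL (mulKVg t)); rewrite mulg1.
by apply: perm_le_id => i; rewrite permM (leq_trans (st _)) // permKV.
Qed.

(** * Representatives of the extended affine Weyl group and uniqueness of [x] *)

Lemma ext_weyl_mxE (x : ext_weyl n) i j :
  ext_weyl_mx K x i j = eps ^ x.2 i * (i == x.1 j)%:R.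
Proof. by rewrite /ext_weyl_mx mul_diag_mx mxE weyl_mxE mxE. Qed.

(** The factor [d] absorbs the signs allowed for [SL], so that both groups are treated alike. *)
Lemma representsE N (x : ext_weyl n) : represents G N x ->
  exists2 d : 'I_n -> L, forall i, val0 (d i) &
    forall i j, N i j = d i * eps ^ x.2 i * (i == x.1 j)%:R.
Proof.
case: G => /= [[_ [b ->]]|->].
  exists (fun i => (-1) ^+ b i) => [i|i j]; first exact: val0_sign.
  by rewrite mul_diag_mx mxE ext_weyl_mxE mxE mulrA.
by exists (fun=> 1) => [_|i j]; [exact: val0_1|rewrite mul1r ext_weyl_mxE].
Qed.

(* Solving u x g = v y h for h g^-1 = y^-1 (v^-1 u) x, whose diagonal entries
   are units, shows that the entries (y.1 j, x.1 j) of v^-1 u are nonzero. *)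
Lemma double_coset_uniq w (x y : ext_weyl n) M :
  in_double_coset G w x M -> in_double_coset G w y M -> x = y.
Proof.
move=> [u [N [g [wu /representsE[d d0 NE] gI ->]]]].
move=> [v [N' [h [wv /representsE[d' d'0 NE'] hI eM]]]].
have ug : g \in unitmx by apply: group_points_unitmx; case: gI.
have uv : v \in unitmx by rewrite unitmxE (conj_unipotent_det wv) unitr1.
have /iwahoriP[_ zi _ zd] : iwahori G (h *m invmx g).
  by apply: iwahori_mul => //; apply: iwahori_inv.
have /conj_unipotentP[q1 q0] : conj_unipotent w (invmx v *m u).
  by apply: conj_unipotent_mul => //; apply: conj_unipotent_inv.
set z := h *m invmx g in zi zd; set q := invmx v *m u in q1 q0.
have eqz : q *m N = N' *m z.
  rewrite /q -mulmxA; apply: (canLR (mulKmx uv)).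
  by rewrite /z !mulmxA -eM mulmxK.
clearbody q z.
have key j : q (y.1 j) (x.1 j) * (d (x.1 j) * eps ^ x.2 (x.1 j)) =
             d' (y.1 j) * eps ^ y.2 (y.1 j) * z j j.
  have /matrixP/(_ (y.1 j) j) := eqz; rewrite !mxE (bigD1 (x.1 j)) //=.
  rewrite NE eqxx mulr1 big1 => [|i ij]; last by rewrite NE (negbTE ij) !mulr0.
  rewrite addr0 => ->; rewrite (bigD1 j) //= NE' eqxx mulr1 big1 ?addr0 // => i ij.
  by rewrite NE' (inj_eq perm_inj) eq_sym (negbTE ij) mulr0 mul0r.
have z0 j : val0 (z j j) by split=> //; have := zd j; rewrite mxE.
have q_neq0 j : q (y.1 j) (x.1 j) != 0.
  apply/eqP => qj; have /esym/eqP := key j; rewrite qj mul0r.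
  by rewrite !mulf_eq0 (negbTE (expz_eps_neq0 _ _)) !(negbTE (val0_neq0 _)).
have yx : y.1 = x.1.
  apply: (mulIg w); apply: perm_le_eq => j; rewrite !permM leqNgt.
  by apply/negP => /q0/eqP; apply/negP.
(* With equal permutations the entry of [q] in [key] is diagonal, hence 1, and only powers of [eps]
   times units remain. *)
have yx2 : y.2 = x.2.
  apply/ffunP => i; have := key (x.1^-1 i)%g; rewrite yx permKV q1 mul1r.
  rewrite [LHS]mulrC [d' _ * _]mulrC -mulrA.
  by move/(eps_val0_inj (d0 _) (val0M (d'0 _) (z0 _))).
by case: x y yx yx2 {NE NE' eqz key q_neq0} => [? ?] [? ?] /= -> ->.
Qed.

(** * Pivots and elementary operations *)

Lemma pivot_exists N r : exists c, pivot N r c.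
Proof.
have [c0 c0P] : exists c0, forall j, (valuation (N r c0) <= valuation (N r j))%E.
  case: (@Order.TotalTheory.arg_minP _ _ _ r xpredT
    (fun j => valuation (N r j))) => // c _ cP.
  by exists c => j; apply: cP.
(* A second minimization, over the columns of minimal valuation, finds the leftmost one. *)
have : (valuation (N r c0) <= valuation (N r c0))%E by [].
case/(@arg_minnP _ c0
  (fun c => valuation (N r c) <= valuation (N r c0))%E val) => c cc0 cmin.
exists c; split=> [j|j jc]; first exact: le_trans cc0 (c0P j).
rewrite ltNge; apply: contraTN jc => jc; rewrite -leqNgt; apply: cmin.
exact: le_trans jc cc0.
Qed.

(** A zero pivot has infinite valuation, so its whole row would vanish and with it the
    determinant. *)
Lemma pivot_neq0 N r c : N \in unitmx -> pivot N r c -> N r c != 0.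
Proof.
move=> uN [cmin _]; apply: contraTneq uN => Nrc.
have row0 j : N r j = 0.
  have := cmin j; rewrite Nrc valuation0 leye_eq => /eqP.
  have [//|/neq0_eps_val0[a [f [f0 ->]]]] := eqVneq (N r j) 0.
  by rewrite eps_val0_valuation.
rewrite unitmxE (expand_det_row _ r) big1 ?unitr0 // => j _.
by rewrite row0 mul0r.
Qed.

Lemma mul_row_elementary N g c :
  (forall i j, i != c \/ j = c -> g i j = (i == j)%:R) ->
  forall i j, (N *m g) i j = if j == c then N i c else N i j + N i c * g c j.
Proof.
move=> gE i j; rewrite mxE; case: eqVneq => [->|jc].
  rewrite (bigD1 c) //= gE; last by right.
  rewrite eqxx mulr1 big1 ?addr0 // => l lc.
  by rewrite gE ?(negbTE lc) ?mulr0 //; left.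
rewrite (bigD1 j) //= (bigD1 c) 1?eq_sym //= gE; last by left.
rewrite eqxx mulr1 big1 ?addr0 // => l /andP[lj lc].
by rewrite gE ?(negbTE lj) ?mulr0 //; left.
Qed.

Lemma mul_col_elementary u N r :
  (forall i j, j != r \/ i = r -> u i j = (i == j)%:R) ->
  forall i j, (u *m N) i j = if i == r then N r j else N i j + u i r * N r j.
Proof.
move=> uE i j; rewrite -[u *m N]trmxK trmx_mul mxE (@mul_row_elementary _ _ r).
  by rewrite !mxE [in RHS]mulrC.
by move=> a b ab; rewrite mxE uE // eq_sym.
Qed.

(** Subtract [N r j / N r c] times column [c]. Minimality makes these quotients integral, and the
    choice of the leftmost minimum makes them divisible by [eps] for [j < c], the places below the
    diagonal of [g]. *)
Lemma clear_row_exists N r c : N \in unitmx -> pivot N r c ->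
  exists N1, clear_row G r c N N1.
Proof.
move=> uN pNc; have Nrc := pivot_neq0 uN pNc; case: pNc => cmin clt.
pose g : 'M[L]_n := \matrix_(i, j)
  if (i == c) && (j != c) then - (N r j / N r c) else (i == j)%:R.
have gE i j : i != c \/ j = c -> g i j = (i == j)%:R.
  by rewrite mxE => -[/negbTE ->|->]; rewrite ?eqxx ?andbF.
exists (N *m g), g; split=> // [|j jc]; last first.
  rewrite (mul_row_elementary N gE) (negbTE jc) mxE eqxx jc mulrN.
  by rewrite mulrC divfK // subrr.
have g1 i : g i i = 1 by rewrite mxE eqxx; case: eqVneq.
have integral_delta (b : bool) : is_integral (b%:R : L).
  by case: b => [|a _]; [exact: (proj1 (val0_1 K))|rewrite lcoef0].
apply/iwahoriP; split=> [|i j|i j ji|i].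
- exact/group_points_det1/det_row_elementary/gE.
- rewrite mxE; case: ifP => // _ a a0; rewrite lcoefN.
  by rewrite (valuation_le_div Nrc (cmin j)) ?oppr0.
- rewrite !mxE; case: ifP => [/andP[/eqP ic _]|_].
    by rewrite lcoefN (valuation_lt_div Nrc) ?oppr0 //; apply: clt; rewrite -ic.
  by rewrite -val_eqE gtn_eqF // lcoef0.
- by rewrite mxE g1 lcoef1 oner_eq0.
Qed.

Definition isolated N r := exists c, [/\ N r c != 0,
  forall j, j != c -> N r j = 0 & forall i, i != r -> N i c = 0].

(** * One round of the procedure *)

Section Round.
Variables (w : 'S_n) (N N1 : 'M[L]_n) (r c : 'I_n).
Hypothesis uN : N \in unitmx.
Hypothesis isoN : forall i : 'I_n, (w r < w i)%N -> isolated N i.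
Hypothesis pNc : pivot N r c.
Hypothesis clearN : clear_row G r c N N1.

(** The condition [w r < w i] says that row [i] was treated before [r]. Its column [ci] has a zero
    in row [r], where the pivot is nonzero. *)
Lemma isolated_pivot i ci : (w r < w i)%N ->
  (forall a, a != i -> N a ci = 0) -> ci != c.
Proof.
move=> ri col0; apply: contraNneq (pivot_neq0 uN pNc) => <-; rewrite col0 //.
by apply: contraTneq ri => ->; rewrite ltnn.
Qed.

Lemma clear_row_pivot_col i : N1 i c = N i c.
Proof.
have [g [_ gE -> _]] := clearN.
by rewrite (mul_row_elementary N gE) eqxx.
Qed.

Lemma isolated_pivot_col0 i : (w r < w i)%N -> N i c = 0.
Proof.
move=> ri; have [ci [Ni row0 col0]] := isoN ri.
by apply: row0; rewrite eq_sym; apply: isolated_pivot ri col0.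
Qed.

(** Row [i] vanishes in the pivot column, so the column operations leave it unchanged. *)
Lemma clear_row_isolated i : (w r < w i)%N -> isolated N1 i.
Proof.
move=> ri; have [ci [Ni row0 col0]] := isoN ri.
have cic := isolated_pivot ri col0; have Nic := isolated_pivot_col0 ri.
have ir : r != i by apply: contraTneq ri => ->; rewrite ltnn.
have [g [_ gE N1E r0]] := clearN.
have N1E' := mul_row_elementary N gE; rewrite -N1E in N1E'.
(* Here [g] is any admissible operation; as row [r] is zero at [ci] before and after it, its
   coefficient there vanishes. *)
have gci : g c ci = 0.
  have := r0 ci cic; rewrite N1E' (negbTE cic) col0 // add0r => /eqP.
  by rewrite mulf_eq0 (negbTE (pivot_neq0 uN pNc)) => /eqP.
exists ci; split=> [|j jci|a ai].
- by rewrite N1E' (negbTE cic) Nic mul0r addr0.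
- by rewrite N1E' Nic mul0r addr0 row0 // if_same.
- by rewrite N1E' (negbTE cic) gci mulr0 addr0 col0.
Qed.

(** Column [c] is already zero in the rows treated earlier, so multiples of row [r] are added only
    where [U'] permits. *)
Lemma clear_column_exists : exists N2, clear_column w r c N1 N2.
Proof.
pose u : 'M[L]_n := \matrix_(i, j)
  if (j == r) && (i != r) then - (N1 i c / N1 r c) else (i == j)%:R.
have uE i j : j != r \/ i = r -> u i j = (i == j)%:R.
  by rewrite mxE => -[/negbTE ->|->]; rewrite ?eqxx ?andbF.
have N1rc : N1 r c != 0 by rewrite clear_row_pivot_col pivot_neq0.
exists (u *m N1), u; split=> // [|i ir]; last first.
  by rewrite (mul_col_elementary N1 uE) (negbTE ir) mxE eqxx ir mulNr divfK // subrr.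
apply/conj_unipotentP; split=> [i|i j ji]; rewrite mxE.
  by rewrite eqxx; case: eqVneq.
case: ifP => [/andP[/eqP jr _]|_].
  by rewrite clear_row_pivot_col isolated_pivot_col0 ?mul0r ?oppr0 // -jr.
by case: eqP ji => // ->; rewrite ltnn.
Qed.

Lemma round_isolated N2 i : clear_column w r c N1 N2 ->
  (w r <= w i)%N -> isolated N2 i.
Proof.
move=> [u [_ uE -> col0]] ri; set N2' := u *m N1 in col0 *.
have N2E := mul_col_elementary N1 uE.
have [g [_ _ _ row0]] := clearN.
have N2r j : N2' r j = N1 r j by rewrite /N2' N2E eqxx.
(* Row [r] is zero outside column [c], so adding multiples of it changes column [c] only. *)
have N2j a j : j != c -> N2' a j = N1 a j.
  by move=> jc; rewrite /N2' N2E; case: eqVneq => [->//|ar];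
    rewrite row0 // mulr0 addr0.
move: ri; rewrite leq_eqVlt => /predU1P[/val_inj/perm_inj <-|ri].
  exists c; split=> // [|j jc]; first by rewrite N2r clear_row_pivot_col pivot_neq0.
  by rewrite N2r row0.
have ir : i != r by apply: contraTneq ri => ->; rewrite ltnn.
have [ci [N1i row1 col1]] := clear_row_isolated ri.
have cic : ci != c.
  apply: contraNneq N1i => ->; rewrite clear_row_pivot_col.
  by rewrite isolated_pivot_col0.
exists ci; split=> [|j jci|a ai]; [by rewrite N2j| |by rewrite N2j // col1].
have [->|jc] := eqVneq j c; first exact: col0.
by rewrite N2j // row1.
Qed.

End Round.

(** * The invariant along the procedure, and feasibility *)

Lemma reached_invariant w M m N : group_points G M -> reached G w M m N ->
  [/\ group_points G N,
      exists u g, [/\ conj_unipotent w u, iwahori G g & M = u *m N *m g] &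
      forall r : 'I_n, (n <= w r + m)%N -> isolated N r].
Proof.
move=> MG; elim=> [|{}m {}N i c N1 N2 _ [NG [u [g [wu gI eM]]] isoN] im pNc clN clN1].
  split=> // [|r]; last by rewrite addn0 leqNgt ltn_ord.
  exists 1%:M, 1%:M; split; [exact: conj_unipotent1|exact: iwahori1|].
  by rewrite mul1mx mulmx1.
have uN := group_points_unitmx NG.
(* Indices start at 0: [n <= w r + m] singles out the rows of the first [m] rounds, and the present
   index is [i = n - m - 1]. *)
have isoN' (a : 'I_n) : (w (w^-1 i)%g < w a)%N -> isolated N a.
  by rewrite permKV => ia; apply: isoN; lia.
have isoN2 (a : 'I_n) := round_isolated uN isoN' pNc clN (i := a) clN1.
have [[h [hI _ eN1 _]] [v [wv _ eN2 _]]] := (clN, clN1).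
have uh : h \in unitmx by apply: group_points_unitmx; case: hI.
have uv : v \in unitmx by rewrite unitmxE (conj_unipotent_det wv) unitr1.
split=> [||a na].
- have hG : group_points G h by case: hI.
  have vG : group_points G v := group_points_det1 (conj_unipotent_det wv).
  by rewrite eN2 eN1; exact: group_points_mul vG (group_points_mul NG hG).
- exists (u *m invmx v), (invmx h *m g); split.
  + by apply: conj_unipotent_mul => //; apply: conj_unipotent_inv.
  + by apply: iwahori_mul => //; apply: iwahori_inv.
  + by rewrite eM eN2 eN1; exact: mulmx_insert_inv.
- by apply: isoN2; rewrite permKV; lia.
Qed.

Lemma feasible w M : group_points G M -> always_feasible G w M.
Proof.
move=> MG m N i /(reached_invariant MG)[NG _ isoN] im r.
have uN := group_points_unitmx NG.
have isoN' (a : 'I_n) : (w r < w a)%N -> isolated N a.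
  by rewrite permKV => ia; apply: isoN; lia.
split; first exact: pivot_exists.
split=> [c|c N1] pNc; first exact: clear_row_exists.
by move=> clN; apply: clear_column_exists uN isoN' pNc clN.
Qed.

(** * Monomial matrices and their representatives *)

Lemma isolated_monomial N : (forall r, isolated N r) -> is_monomial N.
Proof.
move=> isoN; have [f fP] := fin_all_exists isoN.
have f_inj : injective f.
  move=> i j fij; have [_ _ col0] := fP j; have [/eqP Ni _ _] := fP i.
  by have [//|/col0] := eqVneq i j; rewrite -fij.
(* The map [f] sends a row to its column, whereas [is_monomial] asks for the map from columns to
   rows. *)
exists (perm f_inj)^-1%g => i j; rewrite -(inj_eq (@perm_inj _ (perm f_inj))).
rewrite permKV permE; have [Ni row0 _] := fP i.
case: (eqVneq j (f i)) => [->|jf]; first by rewrite Ni.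
by rewrite row0 // eqxx.
Qed.

Lemma iwahori_diag (d : 'rV[L]_n) : (forall j, val0 (d 0 j)) ->
  group_points G (diag_mx d) -> iwahori G (diag_mx d).
Proof.
move=> d0 dG; apply/iwahoriP; split=> // [i j|i j ji|i]; rewrite !mxE.
- by case: eqP => [->|_ a _]; [case: (d0 j)|rewrite lcoef0].
- by rewrite -val_eqE gtn_eqF // lcoef0.
- by rewrite eqxx; case: (d0 i).
Qed.

(** Each nonzero entry is a power of [eps] times a unit, and a diagonal matrix in [I] removes the
    units; for [SL] a sign keeps its determinant 1. *)
Lemma monomial_represents N : (0 < n)%N -> group_points G N -> is_monomial N ->
  exists x h, [/\ in_ext_weyl G x, iwahori G h & represents G (N *m h) x].
Proof.
move=> n_gt0 NG [s sP].
have Nne0 j : N (s j) j != 0 by rewrite sP.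
have [a /fin_all_exists[v vP]] := fin_all_exists (fun j => neq0_eps_val0 (Nne0 j)).
have v0 j : val0 (v j) by case: (vP j).
have NE i j : N i j = (i == s j)%:R * (eps ^ a j * v j).
  have [->|ij] := eqVneq i (s j); first by rewrite mul1r; case: (vP j).
  have := sP i j; rewrite (negbTE ij) mul0r => /negbT.
  by rewrite negbK => /eqP.
(* The exponents [a] are indexed by columns, those of [x] by rows. *)
pose x : ext_weyl n := (s, [ffun i => a (s^-1 i)%g]).
pose h (b : 'I_n -> bool) := diag_mx (\row_j ((-1) ^+ b (s j) / v j)).
have hN b : N *m h b = diag_mx (\row_i (-1) ^+ b i) *m ext_weyl_mx K x.
  apply/matrixP => i j; rewrite mul_mx_diag mul_diag_mx.
  rewrite [LHS]mxE [RHS]mxE ext_weyl_mxE NE !mxE ffunE.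
  have [->|ij] := eqVneq i (s j); last by rewrite !(mul0r, mulr0).
  by rewrite permK mul1r mulr1 mulrACA divff ?val0_neq0 // mulr1 mulrC.
have hI b : group_points G (h b) -> iwahori G (h b).
  apply: iwahori_diag => j; rewrite mxE; apply: val0M; first exact: val0_sign.
  exact: val0V.
have deth b : \det (h b) = (\prod_j (-1) ^+ b j) / \prod_j v j.
  rewrite det_diag [X in X / _](reindex_inj (@perm_inj _ s)) -prodf_div.
  by apply: eq_bigr => j _; rewrite mxE.
move: NG hI; case: G => /= [detN|_] hI.
  (* The sign of [s], placed in row 0 of [N *m h b] alone, gives [h b] determinant 1. *)
  pose b i := (i == Ordinal n_gt0) && odd_perm s.
  have prodb : \prod_j (-1) ^+ b j = (-1) ^+ s :> L.
    rewrite (bigD1 (Ordinal n_gt0)) //= big1 ?mulr1 => [|i /negbTE i0].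
      by rewrite /b eqxx.
    by rewrite /b i0.
  have eN : N = weyl_mx K s *m diag_mx (\row_j (eps ^ a j * v j)).
    by apply/matrixP => i j; rewrite mul_mx_diag NE [RHS]mxE weyl_mxE mxE.
  have eps_prod : \prod_j (eps : L) ^ a j = eps ^ (\sum_j a j).
    apply/esym; apply: (big_morph (fun m => (eps : L) ^ m)) => // c d.
    by rewrite expfzDr ?eps_neq0.
  (* The equation [\det N = 1] splits into a power of [eps] and a unit: the exponents sum to 0 and
     the units [v j] multiply to the sign of [s]. *)
  have : eps ^ (\sum_j a j) * ((-1) ^+ s * \prod_j v j) = eps ^ 0%Z * 1.
    rewrite mulr1 expr0z -[RHS]detN eN det_mulmx det_perm odd_permV det_diag.
    rewrite mulrCA -eps_prod -big_split /=; congr (_ * _).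
    by apply: eq_bigr => j _; rewrite mxE.
  move=> E; have sv0 : val0 ((-1) ^+ s * \prod_j v j).
    by apply: val0M; [exact: val0_sign|exact: val0_prod].
  have suma0 := eps_val0_inj sv0 (val0_1 K) E.
  have dethb : \det (h b) = 1.
    move: E; rewrite suma0 !expr0z !mul1r deth prodb => E.
    by rewrite -[X in _ / X](signrMK s) E mulr1 divff ?signr_eq0.
  exists x, (h b); split; [|exact: hI|].
    apply: etrans suma0; rewrite (reindex_inj (@perm_inj _ s)).
    by apply: eq_bigr => j _; rewrite ffunE permK.
  by rewrite det_mulmx detN dethb mulr1; split=> //; exists b.
exists x, (h (fun=> false)); split=> //.
  apply: hI; rewrite unitmxE deth unitfE big1 // mul1r invr_eq0.
  by apply/prodf_neq0 => j _; apply: val0_neq0.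
rewrite hN (_ : diag_mx _ = 1%:M) ?mul1mx //.
by apply/matrixP => i j; rewrite !mxE.
Qed.

End Groups.

Theorem mainTheorem4 (F : finFieldType) (kbar : closedFieldType)
    (iota : {rmorphism F -> kbar})
    (kbar_algebraic : forall a : kbar, algebraicOver iota a)
    (n : nat) (n_ge2 : (2 <= n)%N) (G : group_kind) (w : 'S_n)
    (M : 'M[laurent kbar]_n) (MG : group_points G M) :
  always_feasible G w M /\
  forall N : 'M[laurent kbar]_n, reached G w M n N ->
    is_monomial N /\
    exists x : ext_weyl n,
      [/\ in_ext_weyl G x /\ in_double_coset G w x M,
          forall y : ext_weyl n,
            in_ext_weyl G y -> in_double_coset G w y M -> y = x,
          exists2 h : 'M[laurent kbar]_n,
            iwahori G h & represents G (N *m h) x &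
          forall (h : 'M[laurent kbar]_n) (y : ext_weyl n),
            iwahori G h -> in_ext_weyl G y -> represents G (N *m h) y -> y = x].
Proof.
split; first exact: feasible.
move=> N /(reached_invariant MG)[NG [u [g [wu gI eM]]] isoN].
have monN : is_monomial N.
  by apply: isolated_monomial => r; apply: isoN; rewrite leq_addl.
split=> //.
have [x [h [xG hI hx]]] := monomial_represents (ltnW n_ge2) NG monN.
(* From [M = u (N h') (h'^-1 g)], any normalization of [N] exhibits a double coset of [M]; both
   uniqueness claims thus reduce to [double_coset_uniq]. *)
have coset (h' : 'M_n) (y : ext_weyl n) :
    iwahori G h' -> represents G (N *m h') y -> in_double_coset G w y M.
  move=> h'I h'y; exists u, (N *m h'), (invmx h' *m g); split=> //.
    by apply: iwahori_mul => //; apply: iwahori_inv.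
  rewrite eM !mulmxA mulmxK //; apply: (@group_points_unitmx _ _ G).
  by case: h'I.
have Mx := coset h x hI hx.
exists x; split=> [|y _ My||h' y h'I _ h'y]; first by split.
- exact: double_coset_uniq My Mx.
- by exists h.
- by apply: double_coset_uniq Mx; apply: coset h'y.
Qed.
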